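(* Let $\alpha, r$ be positive integers. Any $r$-uniform $r$-partite hypergraph $\mathcal H$ with parts $V_1,\dots,V_r$ contains edge-disjoint subhypergraphs $\mathcal A$ and $\mathcal B$ such that (a) for every $S \subseteq V(\mathcal H)$ with $|S| = r-1$, either $\deg_{\mathcal A}(S) = 0$ or $\deg_{\mathcal A}(S) \geq \alpha$; (b) $|\mathcal B| \geq \frac{|\mathcal H \setminus \mathcal A|}{\alpha - 1}$ and $|\mathcal B| \leq \sum_{s=1}^r |\mathcal B[\overline{s}]|$.
   Context: An $r$-uniform hypergraph is a family of $r$-element subsets (edges) of a finite vertex set; it is $r$-partite with parts $V_1,\dots,V_r$ if $V(\mathcal H)=V_1\cup\dots\cup V_r$ is a partition and every edge meets each $V_i$ in exactly one vertex. A subhypergraph is a subfamily of the edges; $\mathcal H\setminus\mathcal A$ is the set of edges of $\mathcal H$ not in $\mathcal A$, and $|\cdot|$ counts edges. For a set $S$ of vertices, $\deg_{\mathcal A}(S)$ is the number of edges of $\mathcal A$ containing $S$. For an edge $e$ and $1\le s\le r$, $e[\overline{s}] = e\setminus V_s$, and for a family $\mathcal B$, $\mathcal B[\overline{s}]=\{e[\overline{s}]: e\in\mathcal B\}$ (as a set, so repeated traces count once). *)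

(* Defs.v *)
From mathcomp Require Import all_boot.

Set Implicit Arguments.
Unset Strict Implicit.
Unset Printing Implicit Defensive.

(* The vertex set is the whole finite type T, and a hypergraph is its set of
   edges. *)
Definition hypergraph (T : finType) := {set {set T}}.

Definition uniform (T : finType) (r : nat) (H : hypergraph T) : Prop :=
  forall e, e \in H -> #|e| = r.

(* Parts may be empty; hence an indexed family rather than finset's
   [partition], whose blocks are nonempty. *)
Definition vertex_partition (T : finType) (r : nat) (V : 'I_r -> {set T}) :
    Prop :=
  \bigcup_(i < r) V i = [set: T] /\
  (forall i j, i != j -> [disjoint V i & V j]).

Definition partite (T : finType) (r : nat) (V : 'I_r -> {set T})
    (H : hypergraph T) : Prop :=
  vertex_partition V /\ (forall e, e \in H -> forall i, #|e :&: V i| = 1).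

Definition hdeg (T : finType) (A : hypergraph T) (S : {set T}) : nat :=
  #|[set e in A | S \subset e]|.

(* e[\bar s] and B[\bar s]; the latter is a set, so equal traces count once. *)
Definition edge_trace (T : finType) (r : nat) (V : 'I_r -> {set T}) (s : 'I_r)
    (e : {set T}) : {set T} := e :\: V s.

Definition trace (T : finType) (r : nat) (V : 'I_r -> {set T}) (s : 'I_r)
    (B : hypergraph T) : {set {set T}} := [set edge_trace V s e | e in B].

(* Main.v *)
Require Import Defs.
From mathcomp Require Import all_boot.

(** While some set [S] of [r - 1] vertices has degree strictly between [0] and
    [alpha] in the current hypergraph, delete the at most [alpha - 1] edges
    through [S], and put one of them, [e], into B. Since [S] is the trace of [e]
    on some side [s] and no edge chosen later contains [S], each choice adds a
    new element to one of the trace families of B. *)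

(** The set [e :\: S] is a single vertex, lying in some part [V s]; as [e] meets [V s] only there,
    removing [V s] from [e] leaves exactly [S]. *)
Lemma subset_edge_trace (T : finType) (r : nat) (V : 'I_r -> {set T})
    (H : hypergraph T) (e S : {set T}) :
  0 < r -> uniform r H -> partite V H -> e \in H -> S \subset e ->
  #|S| = r - 1 -> exists s, edge_trace V s e = S.
Proof.
move=> r_gt0 Hunif [[Vcover _] Hmeet] eH Se cardS.
have /cards1P[x eSx] : #|e :\: S| == 1.
  by rewrite cardsD (setIidPr Se) Hunif // cardS subKn.
have /setDP[xe _] : x \in e :\: S by rewrite eSx set11.
have /bigcupP[s _ xV] : x \in \bigcup_(i < r) V i by rewrite Vcover inE.
exists s.
have /eqP/cards1P[y eVy] := Hmeet e eH s.
have xy : x = y by apply/set1P; rewrite -eVy inE xe.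
have -> : edge_trace V s e = e :\: (e :&: V s) by rewrite setDIr setDv set0U.
by rewrite eVy -xy -eSx setDDr setDv set0U (setIidPr Se).
Qed.

Lemma sum_trace_setU1 (T : finType) (r : nat) (V : 'I_r -> {set T})
    (B : hypergraph T) (e : {set T}) (s : 'I_r) :
  edge_trace V s e \notin trace V s B ->
  \sum_(i < r) #|trace V i B| < \sum_(i < r) #|trace V i (e |: B)|.
Proof.
move=> new; rewrite (bigD1 s) //= [ltnRHS](bigD1 s) //= -addSn leq_add //.
  by rewrite /trace imsetU1 cardsU1 new.
by apply: leq_sum => i _; rewrite subset_leq_card // imsetS // subsetUr.
Qed.

(** The trace hypothesis passes to subfamilies of [H], so strong induction on [#|H|] applies to what
    is left after a deletion. *)
Lemma exists_pruning (alpha r : nat) (T : finType) (V : 'I_r -> {set T})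
    (H : hypergraph T) :
  (forall e S : {set T}, e \in H -> S \subset e -> #|S| = r - 1 ->
     exists s, edge_trace V s e = S) ->
  exists A B : hypergraph T,
    [/\ A \subset H, B \subset H & [disjoint A & B]] /\
    (forall S : {set T}, #|S| = r - 1 -> hdeg A S = 0 \/ alpha <= hdeg A S) /\
    (#|H :\: A| <= (alpha - 1) * #|B| /\
     #|B| <= \sum_(s < r) #|trace V s B|).
Proof.
have [n] := ubnP #|H|; elim: n H => // n IHn H ltHn Htrace.
have [/exists_inP[S /eqP cardS /andP[degS_gt0 degS_lt]]|noS] :=
  boolP [exists (S : {set T} | #|S| == r - 1), 0 < hdeg H S < alpha]; last first.
  (* No deficient [S] remains: all of [H] is kept. *)
  exists H, set0; rewrite subxx sub0set disjoint_sym disjoints_subset sub0set.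
  split=> //; split; last by rewrite setDv !cards0.
  move=> S cardS; case: (posnP (hdeg H S)) => [|degS_gt0]; [by left | right].
  rewrite leqNgt; apply: contra noS => degS_lt.
  by apply/exists_inP; exists S; rewrite ?cardS ?degS_gt0.
pose D := [set e in H | S \subset e].
have /card_gt0P[e eD] : 0 < #|D| by [].
have /andP[eH Se] : (e \in H) && (S \subset e) by move: eD; rewrite inE.
have ltHDn : #|H :\: D| < n.
  rewrite -ltnS (leq_trans _ ltHn) // ltnS [ltnRHS](cardsD1 e) eH ltnS.
  by rewrite subset_leq_card // setDS // sub1set.
have [|A [B [[AHD BHD dAB] [degA [cardHA cardB]]]]] := IHn _ ltHDn.
  by move=> f S' /setDP[fH _]; apply: Htrace.
have AH : A \subset H by apply: subset_trans AHD (subsetDl H D).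
have eA : e \notin A by apply: contraL eD => /(subsetP AHD)/setDP[].
have eB : e \notin B by apply: contraL eD => /(subsetP BHD)/setDP[].
have [s trace_e] := Htrace e S eH Se cardS.
(* An edge [f] of [B] with the same trace would contain [S] and so lie in [D], which [B] avoids. *)
have newS : edge_trace V s e \notin trace V s B.
  apply/imsetP => -[f /(subsetP BHD)/setDP[fH /negP fD]] trace_f; apply: fD.
  by rewrite inE fH -trace_e trace_f subsetDl.
exists A, (e |: B); split; last split => //; last split.
- split=> //; first by rewrite subUset sub1set eH (subset_trans BHD) ?subsetDl.
  rewrite disjoint_sym disjoints_subset subUset sub1set inE eA.
  by rewrite -disjoints_subset disjoint_sym.
- rewrite cardsU1 eB mulnDr muln1.
  (* Since [A] avoids [D], all of [D] is lost: at most [alpha - 1] edges, charged to [e]. The other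
     lost edges are bounded by induction. *)
  have -> : H :\: A = D :|: (H :\: D) :\: A.
    apply/setP => f; rewrite !inE; case fH: (f \in H); rewrite ?andbF //=.
    case: (boolP (S \subset f)) => //= Sf; rewrite ?andbT //.
    by apply: contraL Sf => /(subsetP AHD); rewrite !inE fH andbT.
  apply: leq_trans (leq_card_setU _ _) (leq_add _ cardHA).
  by rewrite leq_subRL ?add1n // (leq_ltn_trans _ degS_lt).
- by rewrite cardsU1 eB add1n (leq_ltn_trans cardB) // (sum_trace_setU1 _ _ _ _ _ _ newS).
Qed.

(* |B| >= |H \ A| / (alpha - 1) is stated with the denominator cleared: for
   alpha = 1 this says H \ A is empty, whereas division by 0 would be vacuous. *)
Theorem theorem3p2 (alpha r : nat) (halpha : 0 < alpha) (hr : 0 < r)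
    (T : finType) (V : 'I_r -> {set T}) (H : hypergraph T)
    (Hunif : uniform r H) (Hpart : partite V H) :
  exists A B : hypergraph T,
    [/\ A \subset H, B \subset H & [disjoint A & B]] /\
    (forall S : {set T}, #|S| = r - 1 -> hdeg A S = 0 \/ alpha <= hdeg A S) /\
    (#|H :\: A| <= (alpha - 1) * #|B| /\
     #|B| <= \sum_(s < r) #|trace V s B|).
Proof.
by apply: exists_pruning => e S; apply: subset_edge_trace.
Qed.
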